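(* Consider the joint spectrum sensing and access coalitional game in partition form on a finite set $\mathcal{N}$ of secondary users (SUs), with the payoffs $x_i(S,\Pi)$, preference relations $\succeq_i$, history sets $h(i)$, switch rule and coalition formation phase defined in the context. Then any partition $\Pi_f$ of $\mathcal{N}$ resulting from the coalition formation phase is Nash-stable.
   Context: **Data.** $\mathcal{N}$ is a finite set of $N$ SUs and $\mathcal{K}$ a finite set of $K$ channels. Channel $k$ is available with probability $\theta_k\in[0,1]$. SU $i$ knows a nonempty subset $\mathcal{K}_i\subseteq\mathcal{K}$. The gains $g_{i,k}>0$ are $g_{i,k}=a_{i,k}d_i^{-\mu}$, where $d_i>0$ is the distance from SU $i$ to the base station, $\mu$ is the path loss exponent and $a_{i,k}$ is a realized fading amplitude. $\tilde P>0$ is the maximum transmit power, $\sigma^2>0$ the noise variance, and $\alpha<1$ (positive) the fraction of a slot needed to sense one channel. SU $i$ gives channel $k$ the weight $w_{i,k}=\theta_k g_{i,k}$. $\mathfrak{P}$ is the set of all partitions of $\mathcal{N}$; a coalition is a nonempty $S\subseteq\mathcal{N}$. For a coalition $S$, a partition $\Pi$ and a channel $k$, $\bar I_{S,k}=\bar I_{S,k}(\Pi)\ge 0$ is the (measured) average interference on channel $k$ experienced by $S$ from the SUs in $\mathcal{N}\setminus S$ when $\Pi$ is in place; it is treated as given. **Cooperative sorting.** Let $\mathcal{K}_S=\bigcup_{i\in S}\mathcal{K}_i$ and $K_S=|\mathcal{K}_S|$. Each $i\in S$ obtains an ordering $\mathcal{K}_i^S$ of $\mathcal{K}_S$, built rank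 by rank for $r=1,\dots,K_S$. Let $\mathcal{Q}_i$ be the set of channels already selected by $i$ at earlier ranks and $\mathcal{K}_{r,S}$ the set of channels already selected by some member of $S$ at rank $r$ (initially empty). In successive rounds, every SU $i\in S$ without a channel at rank $r$ proposes the channel of largest weight $w_{i,k}$ in $\mathcal{K}_S\setminus(\mathcal{K}_{r,S}\cup\mathcal{Q}_i)$. Each proposed channel is given, as rank-$r$ channel, to the proposing SU having the largest weight for it (in particular to the only proposer, if there is just one), and the remaining SUs repeat the procedure. If $\mathcal{K}_S\setminus(\mathcal{K}_{r,S}\cup\mathcal{Q}_i)=\emptyset$ for an SU $i$ still without a rank-$r$ channel, then $i$ simply takes as rank-$r$ channel the channel of largest weight in $\mathcal{K}_S\setminus\mathcal{Q}_i$. Ties are broken by a fixed rule. **Sensing time.** If $\mathcal{K}_i^S=(k_1,\dots,k_{K_S})$, then $$\tau_i^S=\sum_{j=1}^{K_S} j\,\alpha\,\theta_{k_j}\prod_{m=1}^{j-1}(1-\theta_{k_m})+\prod_{l=1}^{K_S}(1-\theta_{k_l}).$$ **Capacity.** A channel selection is a tuple $\mathcal{B}_S=(b_i)_{i\in S}$ with $b_i\in\mathcal{K}_S$. Let $\mathcal{K}^S_{i,b_i}$ be the set of channels preceding $b_i$ in the ordering $\mathcal{K}_i^S$. The tuple is feasible if $\{b_i:i\in S\}\cap\bigcup_{i\in S}\mathcal{K}^S_{i,b_i}=\emptyset$; $\bar{\mathfrak{F}}_S$ is the set of feasible tuples. For a feasible tuple, $$p_{\mathcal{B}_S}=\prod_{k\in\{b_i:\,i\in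 S\}}\theta_k\prod_{j\in\bigcup_{i\in S}\mathcal{K}^S_{i,b_i}}(1-\theta_j).$$ Given a feasible $\mathcal{B}_S$, split $S$ into disjoint groups $S_1,\dots,S_L$ according to the rank of $b_i$ in $\mathcal{K}_i^S$ (same group iff same rank), and let $\mathcal{K}_{S_l}=\{b_i:i\in S_l\}$. SU $i\in S_l$ uses powers $P_{i,k}^{\mathcal{B}_S}\ge0$ for $k\in\mathcal{K}_{S_l}$ (zero on other channels) with $\sum_{k\in\mathcal{K}_{S_l}}P_{i,k}^{\mathcal{B}_S}=\tilde P$. If $|S_l|=1$, the SU uses power $\tilde P$ on its selected channel. If $|S_l|>1$, the powers of the members of $S_l$ are a (fixed) maximizer, under these constraints, of $\sum_{i\in S_l}\sum_{k\in\mathcal{K}_{S_l}}C_{i,k}$, where $$C_{i,k}=\log_2\Big(1+\frac{P_{i,k}^{\mathcal{B}_S}g_{i,k}}{\sigma^2+\sum_{j\in S_l,\,j\ne i}g_{j,k}P_{j,k}^{\mathcal{B}_S}+\sum_{j\in S\setminus S_l}g_{j,k}P_{j,k}^{\mathcal{B}_S}+\bar I_{S,k}}\Big).$$ Let $C_{i,k}^{\mathcal{B}_S}$ be the resulting values, $C_i^{\mathcal{B}_S}=\sum_{k\in\mathcal{K}_{S_l}}C_{i,k}^{\mathcal{B}_S}$ for $i\in S_l$, and $\bar C_i^S=\sum_{\mathcal{B}_S\in\bar{\mathfrak{F}}_S}p_{\mathcal{B}_S}C_i^{\mathcal{B}_S}$. **Payoff.** For $i\in S$, $x_i(S,\Pi)=v_i(S,\Pi)=\bar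 C_i^S\,(1-\tau_i^S)$; the dependence on $\Pi$ is through $\bar I_{S,k}(\Pi)$. **Preferences.** Each SU $i$ has a history set $h(i)$, containing the coalitions of size larger than $1$ that $i$ was a member of in the past and has left. The history sets are empty when the phase starts. For $i\in S$, $$\phi_i(S,\Pi)=\begin{cases}x_i(S,\Pi)&\text{if }\big(x_j(S,\Pi)\ge x_j(S\setminus\{i\},\Pi)\ \forall j\in S\setminus\{i\}\text{ and }S\notin h(i)\big)\text{ or }|S|=1,\\0&\text{otherwise.}\end{cases}$$ For coalitions $S_1\in\Pi$, $S_2\in\Pi'$ containing $i$: $(S_1,\Pi)\succeq_i(S_2,\Pi')\iff\phi_i(S_1,\Pi)\ge\phi_i(S_2,\Pi')$, and $\succ_i$ is the strict (asymmetric) part of $\succeq_i$. **Switch rule.** Given a partition $\Pi=\{S_1,\dots,S_M\}$, an SU $i\in S_m$ leaves $S_m$ and joins $S_k\in\Pi\cup\{\emptyset\}$, $S_k\ne S_m$, forming $\Pi'=(\Pi\setminus\{S_m,S_k\})\cup\{S_m\setminus\{i\},S_k\cup\{i\}\}$ (empty sets discarded), if and only if $(S_k\cup\{i\},\Pi')\succ_i(S_m,\Pi)$. When the switch is performed, $S_m$ is added to $h(i)$ if $|S_m|>1$. **Coalition formation phase.** Starting from an initial partition $\Pi_{\mathrm{init}}$, the SUs act sequentially, one at a time, in an arbitrary (random) order, each investigating whether some switch operation is available to it under the current partition and performing one if so; this is repeated until no SU has an available switch operation. A partition $\Pi_f$ results from the phase if it is the partition in place when the phase terminates in this way. **Nash-stability.**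 A partition $\Pi=\{S_1,\dots,S_M\}$ is Nash-stable if for every $i\in\mathcal{N}$, with $i\in S_m\in\Pi$, one has $(S_m,\Pi)\succeq_i(S_k\cup\{i\},\Pi')$ for all $S_k\in\Pi\cup\{\emptyset\}$, $S_k\neq S_m$, where $\Pi'=(\Pi\setminus\{S_m,S_k\})\cup\{S_m\setminus\{i\},S_k\cup\{i\}\}$ (empty sets discarded). For $\Pi_f$, the relations $\succeq_i$ are taken with the history sets $h(i)$ in place when the phase terminates. *)

(* Defs.v *)
From mathcomp Require Import all_boot all_order all_algebra.
From mathcomp Require Import reals exp.

Set Implicit Arguments.
Unset Strict Implicit.
Unset Printing Implicit Defensive.

Import Order.TTheory GRing.Theory Num.Theory.
Local Open Scope ring_scope.

Section Network.
Variables (R : realType) (SU Ch : finType).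

Definition log2 (x : R) : R := ln x / ln 2.

Definition argmax_set (T : finType) (f : T -> R) (A : {set T}) : {set T} :=
  [set x in A | [forall y in A, f y <= f x]].

(* A tie-breaking rule selects one element from every nonempty set of tied
   candidates, and [None] on the empty set. *)
Definition tie_breaker (T : finType) (tie : {set T} -> option T) : Prop :=
  forall A, if tie A is Some x then x \in A else A == set0.

(* [interf S P k] is the average interference on channel [k] experienced by the
   coalition [S] from the other SUs when the partition [P] is in place; [S]
   need not be a block of [P]. The rule [tie_ch i] resolves ties between the
   channels SU [i] prefers, [tie_su k] ties between the SUs proposing [k]. *)
Record network := Network {
  theta : Ch -> R;
  known : SU -> {set Ch};
  fading : SU -> Ch -> R;
  dist : SU -> R;
  path_loss : R;
  max_power : R;
  noise : R;
  sense_frac : R;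
  interf : {set SU} -> {set {set SU}} -> Ch -> R;
  tie_ch : SU -> {set Ch} -> option Ch;
  tie_su : Ch -> {set SU} -> option SU;
  theta_itv : forall k, 0 <= theta k <= 1;
  known_neq0 : forall i, known i != set0;
  dist_gt0 : forall i, 0 < dist i;
  gain_gt0 : forall i k, 0 < fading i k * dist i `^ (- path_loss);
  max_power_gt0 : 0 < max_power;
  noise_gt0 : 0 < noise;
  sense_frac_itv : 0 < sense_frac < 1;
  interf_ge0 : forall S P k,
    S != set0 -> partition P [set: SU] -> 0 <= interf S P k;
  tie_chP : forall i, tie_breaker (tie_ch i);
  tie_suP : forall k, tie_breaker (tie_su k)
}.

Variable G : network.

Definition gain (i : SU) (k : Ch) : R := fading G i k * dist G i `^ (- path_loss G).

Definition weight (i : SU) (k : Ch) : R := theta G k * gain i k.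

Definition channels (S : {set SU}) : {set Ch} := \bigcup_(i in S) known G i.

(** Cooperative sorting *)

Definition best_ch (i : SU) (A : {set Ch}) : option Ch :=
  tie_ch G i (argmax_set (weight i) A).

Definition best_su (k : Ch) (A : {set SU}) : option SU :=
  tie_su G k (argmax_set (weight^~ k) A).

Section SortRank.
Variables (S : {set SU}) (Q : SU -> {set Ch}).

(* One round at a given rank: [f] records the channels obtained so far at this
   rank and [Q i] the channels selected by [i] at the earlier ranks. *)
Definition sort_round (f : {ffun SU -> option Ch}) : {ffun SU -> option Ch} :=
  let taken := [set k | [exists i in S, f i == Some k]] in
  let avail i := channels S :\: (taken :|: Q i) in
  let waiting i := (i \in S) && (f i == None) in
  let proposal i := if waiting i then best_ch i (avail i) else None in
  [ffun i =>
    if ~~ waiting i then f i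
    else if avail i == set0 then best_ch i (channels S :\: Q i)
    else if proposal i is Some k then
      if best_su k [set j | proposal j == Some k] == Some i then Some k
      else None
    else None].

(* Every round serves at least one waiting member of [S], if there is any, so
   that #|S| rounds exhaust the procedure. *)
Definition sort_rank : {ffun SU -> option Ch} :=
  iter #|S| sort_round [ffun=> None].

End SortRank.

Definition sort_step (S : {set SU}) (s : {ffun SU -> seq Ch}) :
    {ffun SU -> seq Ch} :=
  let f := sort_rank S (fun i => [set k in s i]) in
  [ffun i => if f i is Some k then rcons (s i) k else s i].

Definition ordering (S : {set SU}) (i : SU) : seq Ch :=
  iter #|channels S| (sort_step S) [ffun=> [::]] i.

(* The ordinal [j] below counts from 0, whence the factor [j.+1]. *)
Definition sensing_time (S : {set SU}) (i : SU) : R :=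
  let s := ordering S i in
  \sum_(j < size s)
     (j.+1)%:R * sense_frac G * theta G (tnth (in_tuple s) j) *
       \prod_(k <- take j s) (1 - theta G k)
  + \prod_(k <- s) (1 - theta G k).

(** Channel selections; a tuple indexed by [S] is a function on [SU] with value
    [None] exactly outside [S]. *)

Definition selection (S : {set SU}) (b : {ffun SU -> option Ch}) : bool :=
  [forall i, if b i is Some k then (i \in S) && (k \in channels S)
             else i \notin S].

Definition chosen (b : {ffun SU -> option Ch}) (T : {set SU}) : {set Ch} :=
  [set k | [exists i in T, b i == Some k]].

Definition rank (S : {set SU}) (b : {ffun SU -> option Ch}) (i : SU) :
    option nat :=
  omap (index^~ (ordering S i)) (b i).

Definition preceding (S : {set SU}) (b : {ffun SU -> option Ch}) (i : SU) :
    {set Ch} :=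
  if rank S b i is Some r then [set k in take r (ordering S i)] else set0.

Definition all_preceding (S : {set SU}) (b : {ffun SU -> option Ch}) :
    {set Ch} :=
  \bigcup_(i in S) preceding S b i.

Definition feasible (S : {set SU}) (b : {ffun SU -> option Ch}) : bool :=
  selection S b && (chosen b S :&: all_preceding S b == set0).

Definition sel_prob (S : {set SU}) (b : {ffun SU -> option Ch}) : R :=
  (\prod_(k in chosen b S) theta G k) *
  \prod_(k in all_preceding S b) (1 - theta G k).

Definition group (S : {set SU}) (b : {ffun SU -> option Ch}) (i : SU) :
    {set SU} :=
  [set j in S | rank S b j == rank S b i].

(** Capacities for a power profile [p] of the members of [S] *)

Definition capacity (S : {set SU}) (P : {set {set SU}})
    (b : {ffun SU -> option Ch}) (p : SU -> Ch -> R) (i : SU) (k : Ch) : R :=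
  let T := group S b i in
  log2 (1 + p i k * gain i k /
    (noise G + \sum_(j in T | j != i) gain j k * p j k
             + \sum_(j in S :\: T) gain j k * p j k + interf G S P k)).

Definition group_capacity (S : {set SU}) (P : {set {set SU}})
    (b : {ffun SU -> option Ch}) (p : SU -> Ch -> R) (T : {set SU}) : R :=
  \sum_(i in T) \sum_(k in chosen b T) capacity S P b p i k.

Definition admissible (S : {set SU}) (b : {ffun SU -> option Ch})
    (p : SU -> Ch -> R) : Prop :=
  forall i, i \in S ->
  [/\ forall k, 0 <= p i k,
      forall k, k \notin chosen b (group S b i) -> p i k = 0
    & \sum_(k in chosen b (group S b i)) p i k = max_power G].

Definition power_rule := {set SU} -> {set {set SU}} ->
  {ffun SU -> option Ch} -> SU -> Ch -> R.

(* The powers of each group maximize its sum capacity, those of the members of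
   the other groups being kept fixed. For a singleton group, admissibility
   already forces the full power on the selected channel. *)
Definition optimal_powers (pw : power_rule) : Prop :=
  forall S P b, S != set0 -> partition P [set: SU] -> feasible S b ->
    admissible S b (pw S P b) /\
    forall i, i \in S -> (1 < #|group S b i|)%N ->
    forall q, admissible S b q ->
      (forall j, j \in S :\: group S b i -> q j =1 pw S P b j) ->
      group_capacity S P b q (group S b i)
        <= group_capacity S P b (pw S P b) (group S b i).

Variable pw : power_rule.

Definition sel_capacity (S : {set SU}) (P : {set {set SU}})
    (b : {ffun SU -> option Ch}) (i : SU) : R :=
  \sum_(k in chosen b (group S b i)) capacity S P b (pw S P b) i k.

Definition avg_capacity (S : {set SU}) (P : {set {set SU}}) (i : SU) : R :=
  \sum_(b | feasible S b) sel_prob S b * sel_capacity S P b i.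

Definition payoff (S : {set SU}) (P : {set {set SU}}) (i : SU) : R :=
  avg_capacity S P i * (1 - sensing_time S i).

(** Preferences *)

Definition history := SU -> {set {set SU}}.

Definition pref_value (h : history) (i : SU) (S : {set SU})
    (P : {set {set SU}}) : R :=
  if ([forall j in S :\ i, payoff (S :\ i) P j <= payoff S P j]
      && (S \notin h i)) || (#|S| == 1%N)
  then payoff S P i else 0.

Definition prefers (h : history) (i : SU)
    (x y : {set SU} * {set {set SU}}) : bool :=
  pref_value h i y.1 y.2 <= pref_value h i x.1 x.2.

Definition strictly_prefers (h : history) (i : SU)
    (x y : {set SU} * {set {set SU}}) : bool :=
  prefers h i x y && ~~ prefers h i y x.

(** Switch operations: SU [i] moves from its coalition [Sm] to [Sk], where
    [Sk = set0] means that it becomes alone. *)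

Definition switched (P : {set {set SU}}) (i : SU) (Sm Sk : {set SU}) :
    {set {set SU}} :=
  ((P :\: [set Sm; Sk]) :|: [set Sm :\ i; i |: Sk]) :\ set0.

Definition possible_move (P : {set {set SU}}) (i : SU) (Sm Sk : {set SU}) :
    bool :=
  [&& Sm \in P, i \in Sm, Sk \in set0 |: P & Sk != Sm].

Definition available (P : {set {set SU}}) (h : history) (i : SU)
    (Sm Sk : {set SU}) : bool :=
  possible_move P i Sm Sk &&
  strictly_prefers h i (i |: Sk, switched P i Sm Sk) (Sm, P).

Definition record_leave (h : history) (i : SU) (Sm : {set SU}) : history :=
  fun j => if (j == i) && (1 < #|Sm|)%N then Sm |: h j else h j.

Inductive turn (i : SU) (P : {set {set SU}}) (h : history) :
    {set {set SU}} -> history -> Prop :=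
| turn_switch Sm Sk of available P h i Sm Sk :
    turn i P h (switched P i Sm Sk) (record_leave h i Sm)
| turn_idle of (forall Sm Sk, ~~ available P h i Sm Sk) :
    turn i P h P h.

Inductive phase_reaches (P0 : {set {set SU}}) :
    {set {set SU}} -> history -> Prop :=
| phase_init : phase_reaches P0 P0 (fun=> set0)
| phase_turn i P h P' h' of phase_reaches P0 P h & turn i P h P' h' :
    phase_reaches P0 P' h'.

Definition phase_results (P0 P : {set {set SU}}) (h : history) : Prop :=
  phase_reaches P0 P h /\ forall i Sm Sk, ~~ available P h i Sm Sk.

Definition nash_stable (h : history) (P : {set {set SU}}) : Prop :=
  partition P [set: SU] /\
  forall i Sm Sk, possible_move P i Sm Sk ->
    prefers h i (Sm, P) (i |: Sk, switched P i Sm Sk).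

End Network.

(* Main.v *)
Require Import Defs.
From mathcomp Require Import all_boot all_order all_algebra.
From mathcomp Require Import reals.

Import Order.TTheory.

(** The phase ends only when no switch is available, that is, when no SU strictly prefers a possible
    move under the histories then in place. Preferences compare real values, so they are total, and
    the lack of a strict preference for the move is a weak preference for staying: this is
    Nash-stability. What remains is that the final family is a partition, an invariant carried along
    the phase by [switched_partition]. *)

(** Each SU [x] lies in exactly one set of the new family, named explicitly by [block x]: [xblock]
    gives existence, hence covering, and [blockE] gives uniqueness, hence disjointness. *)
Lemma switched_partition (SU : finType) (P : {set {set SU}}) (i : SU)
    (Sm Sk : {set SU}) :
  partition P [set: SU] -> possible_move P i Sm Sk ->
  partition (switched P i Sm Sk) [set: SU].
Proof.
case/and3P=> /eqP covP tiP P0 /and4P [SmP iSm SkP neSkm].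
have pblockE A x : A \in P -> x \in A -> A = pblock P x.
  by move=> AP xA; rewrite (def_pblock tiP AP xA).
(* [Sk] may be [set0], which is no block of [P]; once it has a member, it is one. *)
have inP A x : A \in set0 |: P -> x \in A -> A \in P.
  by case/setU1P=> [->|//]; rewrite inE.
have disjSkm x : x \in Sk -> x \notin Sm.
  move=> xSk; apply: contraNN neSkm => xSm; apply/eqP.
  by rewrite (pblockE _ _ (inP _ _ SkP xSk) xSk) [RHS](pblockE _ _ SmP xSm).
(* The three cases are the enlarged coalition, the one [i] has left, and the untouched blocks. *)
pose block x := if (x == i) || (x \in Sk) then i |: Sk
                else if x \in Sm then Sm :\ i else pblock P x.
have blockE A x : A \in switched P i Sm Sk -> x \in A -> A = block x.
  rewrite !inE /block => /andP[_ /orP[/andP[+ AP] xA|]].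
    rewrite negb_or => /andP[ASm ASk].
    have xSm : x \notin Sm.
      apply: contra ASm => xSm.
      by rewrite (pblockE _ _ AP xA) -(pblockE _ _ SmP xSm).
    have xSk : x \notin Sk.
      apply: contra ASk => xSk.
      by rewrite (pblockE _ _ AP xA) -(pblockE _ _ (inP _ _ SkP xSk) xSk).
    have xi : x != i by apply: contraNneq xSm => ->.
    by rewrite (negPf xi) (negPf xSk) (negPf xSm) -(pblockE _ _ AP xA).
  case/orP=> /eqP ->; rewrite !inE; last by move->.
  case/andP=> /negPf -> xSm; rewrite xSm.
  by case: ifP => // /disjSkm; rewrite xSm.
have xblock x : (x \in block x) && (block x \in switched P i Sm Sk).
  have xP : x \in cover P by rewrite covP inE.
  have neq0 (A : {set SU}) : x \in A -> A != set0.
    by move=> xA; apply/set0Pn; exists x.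
  rewrite /block; case: ifP => [xiSk|/norP[xi xSk]].
    have xA : x \in i |: Sk by rewrite !inE.
    by rewrite xA !inE neq0 // eqxx !orbT.
  case: ifPn => xSm.
    have xA : x \in Sm :\ i by rewrite !inE xi.
    by rewrite xA !inE neq0 // eqxx !orbT.
  have xA : x \in pblock P x by rewrite mem_pblock.
  rewrite xA !inE neq0 // pblock_mem // andbT /=; apply/orP; left.
  by apply/norP; split; [apply: contraNneq xSm | apply: contraNneq xSk] => <-.
apply/and3P; split; last by rewrite !inE eqxx.
  rewrite -subTset; apply/subsetP => x _.
  by have /andP[xB BP] := xblock x; apply/bigcupP; exists (block x).
apply/trivIsetP => A B AP BP; apply: contraNT => /pred0Pn[x /andP[xA xB]].
by rewrite (blockE _ _ AP xA) [X in _ == X](blockE _ _ BP xB).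
Qed.

Lemma phase_reaches_partition (R : realType) (SU Ch : finType)
    (G : network R SU Ch) (pw : power_rule R SU Ch) (P0 P : {set {set SU}})
    (h : history SU) :
  partition P0 [set: SU] -> phase_reaches G pw P0 P h ->
  partition P [set: SU].
Proof.
move=> partP0; elim=> // i {}P {}h P' h' _ partP [Sm Sk|] //.
by case/andP=> move_i _; apply: switched_partition.
Qed.

Theorem proposition1 (R : realType) (SU Ch : finType) (G : network R SU Ch)
    (pw : power_rule R SU Ch) (hpw : optimal_powers G pw)
    (Pi_init : {set {set SU}}) (hinit : partition Pi_init [set: SU])
    (Pi_f : {set {set SU}}) (h : history SU)
    (hf : phase_results G pw Pi_init Pi_f h) :
  nash_stable G pw h Pi_f.
Proof.
case: hf => reach stuck; split; first exact: phase_reaches_partition reach.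
move=> i Sm Sk move_i; have := stuck i Sm Sk.
rewrite /available move_i andTb /strictly_prefers negb_and negbK /prefers.
(* Abstracting the two values keeps conversion from comparing the payoffs. *)
move: (pref_value _ _ _ _ _ _) (pref_value _ _ _ _ _ _) => x y.
(* Totality of the order on the reals enters here, through [ltNge]. *)
by case/orP=> //; rewrite -ltNge => /ltW.
Qed.
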